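(* Let $N\ge1$, $X>0$, $0\le X_i^-\le X_i^+$ for $i=1,\dots,N$, and let $$B=\Big\{x\in\mathbb{R}^N:\ \sum_{i=1}^N x_i=X,\ X_i^-\le x_i\le X_i^+\text{ for all } i\Big\}$$ be the (nonempty) set of valid budget distributions, of Euclidean diameter $D$. Let $g_1,\dots,g_N$ be deterministic, time-independent productivity functions with $|g_i''(x)|\le\Gamma$ for $x\in[X_i^-,X_i^+]$, let $g(x)=\sum_{i=1}^N g_i(x_i)$, and suppose $\|\nabla g(x)\|\le G$ for all $x\in B$. Let $x^\star$ be a maximizer of $g$ over $B$. Let $\epsilon>0$ and let the budgets $x^k\in B$ be generated, from initial budgets $x^0,x^1\in B$, by the gradient scheme $$x^{k+1}=\pi_B\big(x^k+\epsilon\,\tilde\nabla^k g\big),\qquad (\tilde\nabla^k g)_i=\frac{g_i(x_i^k)-g_i(x_i^{k-1})}{x_i^k-x_i^{k-1}},\quad i=1,\dots,N,\ k\ge1.$$ Then, for every $k\ge 1$, $$\frac1k\sum_{j=1}^k\big(g(x^\star)-g(x^j)\big)\ \le\ \frac{1}{2\epsilon k}\Big(D^2+\epsilon^2k\big(G+\tfrac12\Gamma D\big)\big(G+\tfrac32\Gamma D\big)\Big).$$ In the limit $k\to\infty$ the right-hand side tends to $\frac{\epsilon}{2}\big(G+\tfrac12\Gamma D\big)\big(G+\tfrac32\Gamma D\big)$, which can be made arbitrarily small by decreasing the learning rate $\epsilon$. In this sense the gradient scheme satisfies $\frac1k\sum_{j=1}^k g(x^j)\approx g(x^\star)$.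
   Context: A productivity function is a function $g_i$ on $[0,\infty)$ with $g_i(0)=0$ that is non-decreasing and concave; $g_i(x)$ is the scientific output of research unit $i$ when it receives funds $x$. $\pi_B(z)$ denotes the point of $B$ closest to $z$ in Euclidean norm, and $\|\cdot\|$ is the Euclidean norm. *)

(* Defs.v *)
(* Built on MathComp and MathComp-Analysis, over an arbitrary R : realType. *)
From HB Require Import structures.
From mathcomp Require Import all_boot all_order all_algebra.
From mathcomp Require Import all_classical all_reals all_analysis.

Set Implicit Arguments.
Unset Strict Implicit.
Unset Printing Implicit Defensive.

Import Order.TTheory GRing.Theory Num.Theory.
Import numFieldNormedType.Exports.

Local Open Scope classical_set_scope.
Local Open Scope ring_scope.

(* Functions on [0, +oo[ are encoded as f : R -> R; every definition below uses
   only the values of f on [0, +oo[. *)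

(* Derivatives are taken relative to the domain [0, +oo[: the usual two-sided
   derivative at x > 0, the right derivative at x = 0. *)
Definition slope_filter (R : realType) (f : R -> R) (x : R) :=
  (fun y => (f y - f x) / (y - x)) @ within `[0, +oo[ x^'.

Definition nng_derivable (R : realType) (f : R -> R) (x : R) : Prop :=
  cvg (slope_filter f x).

Definition nng_derive (R : realType) (f : R -> R) (x : R) : R :=
  lim (slope_filter f x).

(* The first derivative has to exist around x, so that the derivative of
   [nng_derive f] at x does not involve junk values of [lim]. *)
Definition nng_twice_derivable (R : realType) (f : R -> R) (x : R) : Prop :=
  (\forall y \near within `[0, +oo[ (nbhs x), nng_derivable f y) /\
  nng_derivable (nng_derive f) x.

Definition nng_derive2 (R : realType) (f : R -> R) (x : R) : R :=
  nng_derive (nng_derive f) x.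

Definition productivity (R : realType) (f : R -> R) : Prop :=
  [/\ f 0 = 0,
      {in `[0, +oo[ &, {homo f : x y / x <= y}} &
      convex_function (`[0, +oo[%classic : set R^o) (fun x => - f x)].

(* The library norm on 'rV[R]_N is the sup norm, hence this definition. *)
Definition enorm (R : realType) (N : nat) (u : 'rV[R]_N) : R :=
  Num.sqrt (\sum_(i < N) u 0 i ^+ 2).

Definition ediam (R : realType) (N : nat) (A : set 'rV[R]_N) : R :=
  sup [set enorm (u - v) | u in A & v in A].

Definition budgets (R : realType) (N : nat) (X : R) (Xm Xp : 'I_N -> R) :
    set 'rV[R]_N :=
  [set x | \sum_(i < N) x 0 i = X /\ forall i, Xm i <= x 0 i <= Xp i].

(* The point of B closest to z; the default z is returned only if there is no
   such point, which cannot happen for a nonempty closed B. *)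
Definition eproj (R : realType) (N : nat) (B : set 'rV[R]_N) (z : 'rV[R]_N) :
    'rV[R]_N :=
  xget z [set p | B p /\ forall q, B q -> enorm (z - p) <= enorm (z - q)].

Definition total_output (R : realType) (N : nat) (g : 'I_N -> R -> R)
    (x : 'rV[R]_N) : R :=
  \sum_(i < N) g i (x 0 i).

(* Partial derivatives relative to the orthant [0, +oo[^N. *)
Definition gradient (R : realType) (N : nat) (f : 'rV[R]_N -> R)
    (x : 'rV[R]_N) : 'rV[R]_N :=
  \row_i nng_derive (fun t => f (\row_j if j == i then t else x 0 j)) (x 0 i).

(* When the two arguments coincide the quotient is read as its limit, the
   derivative (and not as MathComp's 0 / 0 = 0). *)
Definition diff_quotient (R : realType) (f : R -> R) (a b : R) : R :=
  if a == b then nng_derive f a else (f a - f b) / (a - b).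

Definition approx_gradient (R : realType) (N : nat) (g : 'I_N -> R -> R)
    (x y : 'rV[R]_N) : 'rV[R]_N :=
  \row_i diff_quotient (g i) (x 0 i) (y 0 i).

Definition gradient_scheme (R : realType) (N : nat) (B : set 'rV[R]_N)
    (g : 'I_N -> R -> R) (eps : R) (x : nat -> 'rV[R]_N) : Prop :=
  [/\ B (x 0%N), B (x 1%N) &
      forall k, (1 <= k)%N ->
        x k.+1 = eproj B (x k + eps *: approx_gradient g (x k) (x k.-1))].

(* Main.v *)
(* Fejer monotonicity of the projected step gives, with [t = approx_gradient g x y] at
   consecutive budgets [y] and [x],
     2 eps <t, xstar - x> <= |x - xstar|^2 - |x' - xstar|^2 + eps^2 |t|^2.
   The difference quotients need not be gradients at [x], but for a concave function the
   secant through the [i]-th coordinates of [x] and [y] lies above the graph outside of the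
   segment between them, and the graph exceeds it inside by at most
   Gam/2 (z - x_i)(y_i - z) <= Gam/8 (x_i - y_i)^2; hence
     g xstar - g x <= <t, xstar - x> + Gam/8 |x - y|^2.
   For every step but the first one, |x - y| <= min (D, eps L) with L = G + Gam D/2, and the
   error is a fraction of the term of order eps Gam D L in the bound. The first error is
   only bounded by Gam D^2/8, which is not of order eps, and is absorbed by
   [first_step_absorbed]. *)

Require Import Defs.
From HB Require Import structures.
From mathcomp Require Import all_boot all_order all_algebra.
From mathcomp Require Import all_classical all_reals all_analysis.
From mathcomp Require Import ring lra.

Set Implicit Arguments.
Unset Strict Implicit.
Unset Printing Implicit Defensive.

Import Order.TTheory GRing.Theory Num.Theory.
Import numFieldNormedType.Exports.

Local Open Scope classical_set_scope.
Local Open Scope ring_scope.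

(** * Derivatives relative to the half-line, and the mean value theorem for them *)

Section NngDerivative.
Variable R : realType.
Implicit Types (f : R -> R) (x y l : R).

Lemma slope_filter_dist f x l e : slope_filter f x --> l -> 0 < e ->
  \forall y \near x, y != x -> 0 <= y -> `|l - (f y - f x) / (y - x)| < e.
Proof.
move=> fl e0.
have : \forall y \near x, y != x -> y \in `[0, +oo[ ->
    `|l - (f y - f x) / (y - x)| < e.
  exact: fl [set z | `|l - z| < e] (nbhsx_ballx l e e0).
by apply: filterS => y yP yx y0; apply: yP; rewrite ?in_itv/= ?andbT.
Qed.

(** Slopes near [x] are at most [|l| + 1] in absolute value, so [f] is Lipschitz at [x] with this
    constant. *)
Lemma nng_derivable_continuous f x : nng_derivable f x ->
  f y @[y --> within `[0, +oo[ (nbhs x)] --> f x.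
Proof.
move=> fx; apply/cvgrPdist_lt => e e0.
set l := nng_derive f x.
have {}fx : slope_filter f x --> l by [].
have l0 : 0 < `|l| + 1 by rewrite ltr_wpDl.
have h := slope_filter_dist fx ltr01.
have h2 : \forall y \near x, `|x - y| < e / (`|l| + 1).
  by apply: (@nbhsx_ballx R R); rewrite divr_gt0.
apply: filterS2 h h2 => y h1 h2; rewrite /= in_itv/= andbT => y0.
have [->|yx] := eqVneq y x; first by rewrite subrr normr0.
have yx0 : y - x != 0 by rewrite subr_eq0.
have {}h1 := h1 yx y0.
rewrite -normrN opprB -(divfK yx0 (f y - f x)) normrM.
have h3 : `|(f y - f x) / (y - x)| <= `|l| + 1.
  set s := _ / _ in h1 *.
  have -> : s = l - (l - s) by ring.
  by rewrite (le_trans (ler_normB _ _))// lerD2l ltW.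
apply: (@le_lt_trans _ _ ((`|l| + 1) * `|y - x|)); first exact: ler_wpM2r.
by rewrite -ltr_pdivlMl// mulrC distrC.
Qed.

Lemma nng_derivable_is_derive f x : 0 < x -> nng_derivable f x ->
  is_derive x 1 f (nng_derive f x).
Proof.
move=> x0 fx; set l := nng_derive f x.
have {}fx : slope_filter f x --> l by [].
have fl : h^-1 *: (f (h *: 1 + x) - f x) @[h --> 0^'] --> l.
  apply/cvgrPdist_lt => e e0.
  have := slope_filter_dist fx e0.
  move=> /(@nbhs_ballP R R)[d /= d0 dP].
  near=> h.
  have h0 : h != 0 by near: h; exact: nbhs_dnbhs_neq.
  (* The bound by [x] keeps [x + h] in the half-line, so the relative slopes include those on both
     sides of [x]. *)
  have hd : `|h| < Num.min d x.
    near: h; apply: nbhs_dnbhs; rewrite /=.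
    have := @nbhsx_ballx R R 0 (Num.min d x).
    rewrite lt_min d0 x0 => /(_ isT); apply: filterS => h.
    by rewrite /ball/= sub0r normrN.
  move: hd; rewrite lt_min => /andP[hd hx].
  have := dP (h + x); rewrite /ball/= opprD addrCA subrr addr0 normrN hd.
  rewrite -subr_eq0 addrK h0 => /(_ isT isT).
  rewrite scaler1 mulrC; apply.
  by move: hx; rewrite ltr_norml => /andP[? _]; lra.
split; last exact: cvg_lim fl.
by apply/cvg_ex; exists l.
Unshelve. all: by end_near. Qed.

(** The left endpoint may be 0, where the derivative is only one-sided; hence the endpoints are
    treated apart from the interior. *)
Lemma nng_derivable_within_continuous f a b : 0 <= a -> a < b ->
  {in `[a, b], forall y, nng_derivable f y} -> {within `[a, b], continuous f}.
Proof.
move=> a0 ab fab; apply/continuous_within_itvP => //; split.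
- move=> y; rewrite in_itv/= => /andP[ay yb].
  have /fab fy : y \in `[a, b] by rewrite in_itv/= !ltW.
  apply: differentiable_continuous; apply/derivable1_diffP.
  by have [] := nng_derivable_is_derive (le_lt_trans a0 ay) fy.
- have /fab/nng_derivable_continuous fa : a \in `[a, b] by rewrite in_itv/= lexx ltW.
  move=> P /fa aP; suff : \forall y \near a, a < y -> P (f y) by [].
  have {}aP : \forall y \near a, y \in `[0, +oo[ -> P (f y) by exact: aP.
  apply: filterS aP => y yP ay.
  by apply: yP; rewrite in_itv/= andbT (le_trans a0)// ltW.
- have /fab/nng_derivable_continuous fb : b \in `[a, b] by rewrite in_itv/= lexx ltW.
  have b0 : 0 < b by exact: le_lt_trans ab.
  move=> P /fb bP; suff : \forall y \near b, y < b -> P (f y) by [].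
  have {}bP : \forall y \near b, y \in `[0, +oo[ -> P (f y) by exact: bP.
  apply: filterS2 bP (lt_nbhsr b0) => y yP y0 _.
  by apply: yP; rewrite in_itv/= andbT ltW.
Qed.

Lemma nng_MVT f a b : 0 <= a -> a < b ->
  {in `[a, b], forall y, nng_derivable f y} ->
  exists2 c, c \in `]a, b[ & f b - f a = nng_derive f c * (b - a).
Proof.
move=> a0 ab fab; apply: MVT => //; last exact: nng_derivable_within_continuous.
move=> y yab; apply: nng_derivable_is_derive.
  by move: yab; rewrite in_itv/= => /andP[/(le_lt_trans a0)].
by apply: fab; move: yab; rewrite !in_itv/= => /andP[? ?]; rewrite !ltW.
Qed.

End NngDerivative.

(** * Chords and tangents of concave functions *)

Section ConcaveFunction.
Variable R : realType.
Implicit Types (f : R -> R) (a b y s : R).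

Lemma productivity_concave f a b s : productivity f -> 0 <= a -> 0 <= b ->
  0 <= s <= 1 -> s * f b + (1 - s) * f a <= f (a + s * (b - a)).
Proof.
move=> [_ _ fc] a0 b0 s01.
have /andP[s0 s1] := s01.
have : - f (s * b + (1 - s) * a) <= s * - f b + (1 - s) * - f a.
  by apply: (fc (Itv01 s0 s1)); rewrite !inE/= in_itv/= andbT.
rewrite (_ : a + s * (b - a) = s * b + (1 - s) * a); first by lra.
by ring.
Qed.

Lemma concave_chord_le f a y b : productivity f -> 0 <= a -> a <= y -> y <= b ->
  (b - y) * f a + (y - a) * f b <= (b - a) * f y.
Proof.
move=> fP a0 ay yb.
have [ab|] := ltP a b; last first.
  by move=> ba; have -> : y = a; [lra|have -> : b = a; lra].
have ba0 : 0 < b - a by rewrite subr_gt0.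
have s01 : 0 <= (y - a) / (b - a) <= 1.
  by rewrite ler_pdivrMr// mul1r lerD2r yb andbT divr_ge0 ?subr_ge0// ltW.
have := productivity_concave fP a0 (le_trans a0 (ltW ab)) s01.
rewrite divfK ?gt_eqF// addrCA subrr addr0 => h.
have := ler_wpM2l (ltW ba0) h; apply: le_trans.
by rewrite le_eqVlt; apply/orP; left; apply/eqP; field; rewrite gt_eqF.
Qed.

(** If [f b] exceeded the tangent, concavity would keep the slope from [a] to each [a + s * (b - a)]
    a fixed amount away from [l], against the convergence of slopes as [s] tends to 0. *)
Lemma concave_tangent_ge f a b : productivity f -> 0 <= a -> 0 <= b ->
  nng_derivable f a -> f b <= f a + nng_derive f a * (b - a).
Proof.
move=> fP a0 b0 fa; set l := nng_derive f a.
have {}fa : slope_filter f a --> l by [].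
have [->|ba] := eqVneq b a; first by rewrite subrr mulr0 addr0.
have ba0 : b - a != 0 by rewrite subr_eq0.
have nba0 : 0 < `|b - a| by rewrite normr_gt0.
rewrite leNgt; apply/negP => h.
set e := (f b - f a - l * (b - a)) / `|b - a|.
have e0 : 0 < e by rewrite divr_gt0//; lra.
have /(@nbhs_ballP R R)[d /= d0 dP] := slope_filter_dist fa e0.
(* Half the minimum gives both [s <= 1], for concavity, and [s * |b - a| < d], for the slope
   estimate. *)
set s := Num.min (d / `|b - a|) 1 / 2.
have dba : 0 < d / `|b - a| by rewrite divr_gt0.
have m0 : 0 < Num.min (d / `|b - a|) 1 by rewrite lt_min dba ltr01.
have s0 : 0 < s by rewrite divr_gt0.
have s1 : s <= 1.
  by rewrite ler_pdivrMr// (@le_trans _ _ 1)// ?ge_min ?lexx ?orbT//; lra.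
have sd : s * `|b - a| < d.
  rewrite -ltr_pdivlMr// (@lt_le_trans _ _ (Num.min (d / `|b - a|) 1))//.
    by rewrite /s; lra.
  by rewrite ge_min lexx.
have s01 : 0 <= s <= 1 by rewrite s1 ltW.
have cs := productivity_concave fP a0 b0 s01.
have := dP (a + s * (b - a)).
rewrite /ball/= opprD addrA subrr add0r normrN normrM gtr0_norm// => /(_ sd).
rewrite -subr_eq0 addrAC subrr add0r mulf_eq0 gt_eqF//= => /(_ ba0).
have -> : 0 <= a + s * (b - a).
  by rewrite (_ : _ + _ = s * b + (1 - s) * a); [rewrite addr_ge0// mulr_ge0//; lra|ring].
move=> /(_ isT); rewrite ltr_pdivlMr// -normrM; set v := (_ - _) * _ => vh.
have vs : v * s = l * (b - a) * s - (f (a + s * (b - a)) - f a).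
  by rewrite /v; field; rewrite ba0 gt_eqF.
have : - v * s < (f b - f a - l * (b - a)) * s.
  by rewrite ltr_pM2r// (le_lt_trans _ vh)// -normrN ler_norm.
by lra.
Qed.

(** * Secant estimates under a bound on the second derivative *)

Section SecondDerivativeBound.
Variables (f : R -> R) (m p Gam : R).
Hypotheses (m0 : 0 <= m) (fP : productivity f).
Hypothesis f_diff : forall t, m <= t <= p ->
  nng_twice_derivable f t /\ `|nng_derive2 f t| <= Gam.

Lemma twice_derivable_derivable t : m <= t <= p -> nng_derivable f t.
Proof.
move=> tI; have [[+ _] _] := f_diff tI.
have t0 : 0 <= t by case/andP: tI => + _; exact: le_trans.
move=> tn; have {}tn : \forall y \near t, y \in `[0, +oo[ -> nng_derivable f y.
  exact: tn.
by apply: (nbhs_singleton tn); rewrite in_itv/= andbT.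
Qed.

Lemma nng_derive_lipschitz s t : m <= s -> s <= t -> t <= p ->
  nng_derive f s - nng_derive f t <= Gam * (t - s).
Proof.
move=> ms; rewrite le_eqVlt => /predU1P[-> _|st tp]; first by rewrite !subrr mulr0.
have [|c + e] := @nng_MVT R (nng_derive f) s t (le_trans m0 ms) st.
  move=> y; rewrite in_itv/= => /andP[sy yt].
  by have [|[_]] := @f_diff y => //; rewrite (le_trans ms)// (le_trans yt).
rewrite in_itv/= => /andP[sc ct].
have [|_] := @f_diff c; first by rewrite (le_trans ms (ltW sc)) (le_trans (ltW ct)).
rewrite ler_norml => /andP[+ _] => h.
rewrite -[leLHS]opprB e -mulNr ler_wpM2r// ?subr_ge0 ?(ltW st)//.
by rewrite lerNl.
Qed.

(** The quadratic term compensates the concavity of [f]: the derivative of [F] is nondecreasing on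
    [[m, p]], so [F] is convex there. *)
Let F t := f t + Gam / 2 * t ^+ 2.

Let F_MVT s t : m <= s -> s < t -> t <= p -> exists2 c, s < c < t &
  F t - F s = (nng_derive f c + Gam * c) * (t - s).
Proof.
move=> ms st tp.
have s0 : 0 <= s by exact: le_trans ms.
have fst : {in `[s, t], forall y, nng_derivable f y}.
  move=> y; rewrite in_itv/= => /andP[sy yt]; apply: twice_derivable_derivable.
  by rewrite (le_trans ms)// (le_trans yt).
have [||c cst] := @MVT R F (fun c => nng_derive f c + Gam * c) s t st.
- move=> y yst.
  have : is_derive y 1 f (nng_derive f y).
    apply: nng_derivable_is_derive.
      by move: yst; rewrite in_itv/= => /andP[/(le_lt_trans s0)].
    apply: fst; move: yst; rewrite !in_itv/= => /andP[? ?]; by rewrite !ltW.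
  move=> fy; rewrite /F; apply: is_derive_eq.
  by rewrite /GRing.scale/=; field.
- have qc : continuous (fun t : R => Gam / 2 * t ^+ 2).
    by move=> y; apply: cvgM; [exact: cvg_cst|exact: exprn_continuous].
  move=> y; apply: cvgD; last exact: continuous_subspaceT qc y.
  exact: nng_derivable_within_continuous.
- by exists c => //; move: cst; rewrite in_itv.
Qed.

Let dF_mono s t : m <= s -> s <= t -> t <= p ->
  nng_derive f s + Gam * s <= nng_derive f t + Gam * t.
Proof. by move=> ms st tp; have := nng_derive_lipschitz ms st tp; lra. Qed.

(** This is convexity of [F], whose mean slope over [[a, y]] is at most that over [[y, b]]; the last
    term is what the quadratic part of [F] contributes. *)
Lemma interpolation_error a y b : m <= a -> a <= y -> y <= b -> b <= p ->
  (b - a) * f y <= (b - y) * f a + (y - a) * f b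
                   + Gam / 2 * (y - a) * (b - y) * (b - a).
Proof.
move=> ma; rewrite le_eqVlt => /predU1P[<- _ _|ay]; first by lra.
rewrite le_eqVlt => /predU1P[<- _|yb bp]; first by lra.
have yp : y <= p by rewrite (le_trans (ltW yb)).
have my : m <= y by rewrite (le_trans ma)// ltW.
have [c /andP[ac cy] ec] := F_MVT ma ay yp.
have [d /andP[yd db] ed] := F_MVT my yb bp.
have := dF_mono (le_trans ma (ltW ac)) (ltW (lt_trans cy yd)) (le_trans (ltW db) bp).
have yab : 0 <= (y - a) * (b - y) by rewrite mulr_ge0// subr_ge0 ltW.
move=> /(ler_wpM2l yab).
rewrite (_ : (y - a) * (b - y) * _ = (F y - F a) * (b - y)); last by rewrite ec; ring.
rewrite (_ : (y - a) * (b - y) * _ = (F b - F y) * (y - a)); last by rewrite ed; ring.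
by rewrite /F; lra.
Qed.

(** The convex function [F] lies above its tangent at [a]. *)
Lemma taylor_lower a b : m <= a <= p -> m <= b <= p ->
  f a + nng_derive f a * (b - a) - Gam / 2 * (b - a) ^+ 2 <= f b.
Proof.
move=> /andP[ma ap] /andP[mb bp].
suff : (nng_derive f a + Gam * a) * (b - a) <= F b - F a by rewrite /F; lra.
have [ab|ba|->] := ltgtP a b; last by rewrite !subrr mulr0.
- have [c /andP[ac cb] ->] := F_MVT ma ab bp.
  rewrite ler_wpM2r ?subr_ge0 ?(ltW ab)//.
  by apply: dF_mono => //; [rewrite ltW|rewrite (le_trans (ltW cb))].
- have [c /andP[ac cb] e] := F_MVT mb ba ap.
  rewrite -lerN2 opprB -mulrN opprB e ler_wpM2r ?subr_ge0 ?(ltW ba)//.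
  by apply: dF_mono => //; [rewrite (le_trans mb (ltW ac))|rewrite ltW].
Qed.

(** After multiplication by [|a - b|], one side is the tangent bound of concavity and the other is
    [taylor_lower]. *)
Lemma diff_quotient_derive a b : m <= a <= p -> m <= b <= p ->
  `|diff_quotient f a b - nng_derive f a| <= Gam / 2 * `|a - b|.
Proof.
move=> aI bI; rewrite /diff_quotient.
have [->|ab] := eqVneq a b; first by rewrite !subrr normr0 mulr0.
have /andP[ma _] := aI; have /andP[mb _] := bI.
have up := concave_tangent_ge fP (le_trans m0 ma) (le_trans m0 mb)
  (twice_derivable_derivable aI).
have lo := taylor_lower aI bI.
have ab0 : a - b != 0 by rewrite subr_eq0.
have nab0 : 0 < `|a - b| by rewrite normr_gt0.
rewrite -(ler_pM2r nab0) -normrM mulrBl divfK//.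
rewrite (_ : Gam / 2 * _ * _ = Gam / 2 * `|a - b| ^+ 2); last by ring.
rewrite real_normK ?num_real//.
by rewrite ler_norml; apply/andP; split; lra.
Qed.

Lemma secant_overestimate a b y : m <= a <= p -> m <= b <= p -> m <= y <= p ->
  f y - f a - diff_quotient f a b * (y - a) <= Gam / 8 * (a - b) ^+ 2.
Proof.
move=> aI bI yI; rewrite /diff_quotient.
have /andP[ma ap] := aI; have /andP[mb bp] := bI; have /andP[my yp] := yI.
have [->|] := eqVneq a b.
  rewrite subrr expr0n mulr0 subr_le0 lerBlDl -lerBlDl lerBlDl.
  exact: concave_tangent_ge fP (le_trans m0 mb) (le_trans m0 my)
    (twice_derivable_derivable bI).
have Gam0 : 0 <= Gam by have [_] := f_diff aI; exact: le_trans.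
(* Exchanging [a] and [b] leaves the secant line, and hence the left-hand side, unchanged. *)
wlog ab : a b aI bI ma ap mb bp / a < b.
  move=> wl nab; have [ab|ba|/eqP] := ltgtP a b; [exact: wl| |by rewrite (negPf nab)].
  have := wl _ _ bI aI mb bp ma ap ba; rewrite eq_sym => /(_ nab).
  rewrite -[(b - a) ^+ 2]sqrrN opprB; apply: le_trans.
  rewrite le_eqVlt; apply/orP; left; apply/eqP; field.
  by rewrite !subr_eq0 (negPf nab) eq_sym nab.
move=> nab; have ba0 : 0 < b - a by rewrite subr_gt0.
rewrite -(ler_pM2r ba0).
rewrite (_ : _ * (b - a) = (b - a) * f y - (b - y) * f a - (y - a) * f b); last first.
  by field; rewrite subr_eq0.
have B0 : 0 <= Gam / 8 * (a - b) ^+ 2 * (b - a).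
  by rewrite mulr_ge0 ?(ltW ba0)// mulr_ge0 ?sqr_ge0// divr_ge0.
have [ya|ay] := leP y a.
  by apply: le_trans B0; have := concave_chord_le fP (le_trans m0 my) ya (ltW ab); lra.
have [yb|by_] := leP y b; last first.
  apply: le_trans B0.
  by have := concave_chord_le fP (le_trans m0 ma) (ltW ab) (ltW by_); lra.
have := interpolation_error ma (ltW ay) yb bp.
(* This square is [(b - a)^2 - 4 (y - a) (b - y)]; it turns the interpolation error into its value
   at the midpoint. *)
have : 0 <= Gam / 8 * (b - a) * (a + b - 2 * y) ^+ 2.
  by rewrite mulr_ge0 ?sqr_ge0// mulr_ge0 ?(ltW ba0)// divr_ge0.
by lra.
Qed.

End SecondDerivativeBound.

End ConcaveFunction.

(** * Inner product and Euclidean norm *)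

Section Euclidean.
Variables (R : realType) (N : nat).
Implicit Types (u v w : 'rV[R]_N) (a : R).

Definition dot u v : R := \sum_(i < N) u 0 i * v 0 i.

Lemma dotC u v : dot u v = dot v u.
Proof. by apply: eq_bigr => i _; rewrite mulrC. Qed.

Lemma dotDr u v w : dot u (v + w) = dot u v + dot u w.
Proof. by rewrite -big_split; apply: eq_bigr => i _; rewrite mxE mulrDr. Qed.

Lemma dotZr a u v : dot u (a *: v) = a * dot u v.
Proof. by rewrite mulr_sumr; apply: eq_bigr => i _; rewrite mxE mulrCA. Qed.

Lemma enorm_ge0 u : 0 <= enorm u.
Proof. exact: sqrtr_ge0. Qed.

Lemma sqr_enorm u : enorm u ^+ 2 = dot u u.
Proof.
rewrite sqr_sqrtr; last by apply: sumr_ge0 => i _; exact: sqr_ge0.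
by apply: eq_bigr => i _; rewrite expr2.
Qed.

Lemma sqr_enormD u v : enorm (u + v) ^+ 2 = enorm u ^+ 2 + 2 * dot u v + enorm v ^+ 2.
Proof. by rewrite !sqr_enorm dotDr ![dot (u + v) _]dotC !dotDr (dotC v u); ring. Qed.

Lemma enormZ a u : enorm (a *: u) = `|a| * enorm u.
Proof.
apply/eqP; rewrite -(@eqrXn2 _ 2) ?mulr_ge0 ?enorm_ge0//; apply/eqP.
by rewrite exprMn !sqr_enorm dotZr dotC dotZr real_normK ?num_real//; ring.
Qed.

Lemma enormN u : enorm (- u) = enorm u.
Proof. by rewrite -scaleN1r enormZ normrN1 mul1r. Qed.

Lemma enorm_le u v : (forall i, `|u 0 i| <= `|v 0 i|) -> enorm u <= enorm v.
Proof.
move=> uv; apply: ler_wsqrtr; apply: ler_sum => i _.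
by rewrite -real_normK ?num_real// -[leRHS]real_normK ?num_real// lerXn2r ?nnegrE.
Qed.

Lemma dot_le_enorm u v : dot u v <= enorm u * enorm v.
Proof.
have dot0 w w' : enorm w = 0 -> dot w w' = 0.
  move=> w0; have : dot w w = 0 by rewrite -sqr_enorm w0 expr0n.
  rewrite /dot => /eqP; rewrite psumr_eq0 => [/allP h|i _]; last by rewrite -expr2 sqr_ge0.
  apply: big1 => i _; have /eqP := h i (mem_index_enum i).
  by move=> /eqP; rewrite mulf_eq0 orbb => /eqP ->; rewrite mul0r.
have [u0|u0] := eqVneq (enorm u) 0; first by rewrite dot0// u0 mul0r.
have [v0|v0] := eqVneq (enorm v) 0; first by rewrite dotC dot0// v0 mulr0.
have uv0 : 0 < enorm u * enorm v by rewrite mulr_gt0// lt_def ?u0 ?v0 enorm_ge0.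
(* The square expands to [2 |u| |v| (|u| |v| - <u, v>)], which gives Cauchy-Schwarz after
   division. *)
have := sqr_ge0 (enorm (enorm v *: u + - enorm u *: v)).
rewrite sqr_enormD !enormZ normrN !ger0_norm ?enorm_ge0// dotZr (dotC _ v) dotZr (dotC v) => h.
by rewrite -subr_ge0 -(pmulr_rge0 _ uv0); lra.
Qed.

Lemma ler_enormD u v : enorm (u + v) <= enorm u + enorm v.
Proof.
rewrite -(@ler_pXn2r _ 2) ?nnegrE ?addr_ge0 ?enorm_ge0// sqr_enormD.
by have := dot_le_enorm u v; lra.
Qed.

Lemma sum_continuous (F : 'I_N -> 'rV[R]_N -> R) :
  (forall i, continuous (F i)) -> continuous (fun u => \sum_(i < N) F i u).
Proof.
move=> Fc u; have uF : Filter (nbhs u) by exact: nbhs_filter.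
apply: (@cvg_big R _ +%R 0 predT _ _ (nbhs u) (index_enum 'I_N) F (fun i => F i u) uF).
  exact: add_continuous.
by move=> i _; exact: Fc.
Qed.

Lemma enorm_continuous : continuous (@enorm R N).
Proof.
move=> u.
apply: (@continuous_comp _ _ _ (fun v : 'rV[R]_N => \sum_(i < N) v 0 i ^+ 2) Num.sqrt).
  apply: sum_continuous => i v.
  apply: (@continuous_comp _ _ _ (fun M : 'rV[R]_N => M 0 i) (fun x => x ^+ 2)).
    exact: coord_continuous.
  exact: exprn_continuous.
exact: sqrt_continuous.
Qed.

End Euclidean.

(** * The set of budgets and the projection onto it *)

Section Budgets.
Variables (R : realType) (N : nat) (X : R) (Xm Xp : 'I_N -> R).
Implicit Types (p q u v z : 'rV[R]_N).
Let B := budgets X Xm Xp.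

Lemma budgets_compact : compact B.
Proof.
have -> : B = [set v : 'rV[R]_N | forall i, `[Xm i, Xp i]%classic (v 0 i)] `&`
              (fun v : 'rV[R]_N => \sum_i v 0 i) @^-1` [set X].
  by apply/seteqP; split=> v [] /= h1 h2; split=> //= i; have := h2 i; have := h1 i; rewrite /= in_itv.
apply: compact_closedI.
  apply: (@rV_compact R N (fun i => `[Xm i, Xp i]%classic)) => i.
  exact: segment_compact.
apply: closed_comp; last exact: closed_eq.
by move=> v _; apply: sum_continuous => i; exact: coord_continuous.
Qed.

Lemma budgets_convex p q s : B p -> B q -> 0 <= s <= 1 -> B (p + s *: (q - p)).
Proof.
move=> [ps pI] [qs qI] /andP[s0 s1]; split.
  under eq_bigr do rewrite !mxE.
  by rewrite big_split/= -mulr_sumr sumrB ps qs subrr mulr0 addr0.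
move=> i; rewrite !mxE.
have /andP[p1 p2] := pI i; have /andP[q1 q2] := qI i.
have {}s1 : 0 <= 1 - s by rewrite subr_ge0.
have := ler_wpM2l s0 q1; have := ler_wpM2l s0 q2.
have := ler_wpM2l s1 p1; have := ler_wpM2l s1 p2.
by move=> *; apply/andP; split; lra.
Qed.

(** The distance to [z] attains its minimum on the compact set [B], so [xget] does not fall back on
    its default. *)
Lemma eproj_budgets z : B !=set0 ->
  B (eproj B z) /\ forall q, B q -> enorm (z - eproj B z) <= enorm (z - q).
Proof.
move=> B0; apply: (@xgetPex _ _ [set p | B p /\ forall q, B q -> enorm (z - p) <= enorm (z - q)]).
have [|c + cB] := @compact_EVT_min _ R (fun q => enorm (z - q)) B B0 budgets_compact.
  apply: continuous_subspaceT => q.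
  apply: (@continuous_comp _ _ _ (fun q : 'rV[R]_N => z - q) (@enorm R N)).
    have qF : Filter (nbhs q) by exact: nbhs_filter.
    by apply: cvgB; [exact: cvg_cst|exact: cvg_id].
  exact: enorm_continuous.
rewrite inE => Bc; exists c; split => // q Bq; by apply: cB; rewrite inE.
Qed.

(** The vectors [z - p] and [q - p] form an angle that is not acute; expanding [|z - q|^2] around
    [p] then gives the bound. *)
Lemma eproj_budgets_dist z q : B q -> enorm (eproj B z - q) <= enorm (z - q).
Proof.
move=> Bq; have [|Bp pmin] := @eproj_budgets z; first by exists q.
set p := eproj B z in Bp pmin *.
have dot_le : dot (z - p) (q - p) <= 0.
  rewrite leNgt; apply/negP => d0.
  set d := dot _ _ in d0; set n := enorm (q - p) ^+ 2.
  have n0 : 0 <= n by exact: sqr_ge0.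
  (* Minimality of [p] against the point at fraction [s] from [p] to [q] yields [2 d <= s n], while
     this choice of [s] makes [s n = d - s d < d]. *)
  set s := d / (d + n).
  have dn0 : 0 < d + n by rewrite ltr_wpDr.
  have s0 : 0 < s by rewrite divr_gt0.
  have s1 : s <= 1 by rewrite ler_pdivrMr// mul1r lerDl.
  have sn : s * (d + n) = d by rewrite divfK// gt_eqF.
  have := pmin _ (budgets_convex Bp Bq (_ : 0 <= s <= 1)).
  rewrite s1 ltW// => /(_ isT).
  rewrite (_ : z - (p + _) = (z - p) + (- s) *: (q - p)); last first.
    by rewrite scaleNr opprD addrA.
  rewrite -(@ler_pXn2r _ 2) ?nnegrE ?enorm_ge0// (sqr_enormD (z - p)) dotZr enormZ exprMn.
  rewrite normrN real_normK ?num_real// -/d -/n => h.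
  have {h} : 2 * d <= s * n.
    by rewrite -(ler_pM2l s0); lra.
  by have : 0 < s * d; [rewrite mulr_gt0|lra].
rewrite -(@ler_pXn2r _ 2) ?nnegrE ?enorm_ge0//.
rewrite (_ : z - q = (z - p) + (- 1) *: (q - p)); last first.
  by rewrite scaleN1r opprB addrA subrK.
rewrite (sqr_enormD (z - p)) dotZr enormZ normrN1 mul1r -enormN opprB.
by have := sqr_ge0 (enorm (z - p)); lra.
Qed.

Lemma enorm_le_ediam u v : B u -> B v -> enorm (u - v) <= ediam B.
Proof.
move=> Bu Bv; apply: ub_le_sup; last by exists u => //; exists v.
(* The diagonal of the box bounds all distances, so the supremum is over a bounded set. *)
exists (enorm (\row_i (Xp i - Xm i))) => _ [p [_ pI]] [q [_ qI]] <-.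
apply: enorm_le => i; rewrite !mxE.
have /andP[p1 p2] := pI i; have /andP[q1 q2] := qI i.
by rewrite [leRHS]ger0_norm ?ler_norml; [apply/andP; split|]; lra.
Qed.

End Budgets.

(** * The gradient of a separable function, and the inequality for the first step *)

Lemma gradient_total_output (R : realType) (N : nat) (g : 'I_N -> R -> R)
    (x : 'rV[R]_N) i :
  gradient (total_output g) x 0 i = nng_derive (g i) (x 0 i).
Proof.
rewrite mxE /nng_derive /slope_filter.
set h := (fun y => _ / _); set h' := (fun y => _ / _).
suff -> : h = h' by [].
apply/funext => y; congr (_ / _).
(* All summands but the [i]-th cancel in the numerator, so the quotients agree before any limit is
   taken. *)
rewrite /total_output (bigD1 i)//= [X in _ - X](bigD1 i)//= !mxE eqxx.
rewrite opprD addrACA (_ : \sum_(j < N | _) _ - _ = 0) ?addr0//.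
by rewrite -sumrB big1// => j ji; rewrite !mxE (negPf ji) subrr.
Qed.

(* The displacement [x 1 - x 0] is not of order [eps]; its error [eps * Gam * D ^+ 2 / 4]
   is paid for either by the slack of the later steps, if [D <= 3 * r], or else because
   a path of length [r < D / 3] cannot bring the distance to the maximizer down to 0. *)
Lemma first_step_absorbed (R : realFieldType) (D Gam L eps r d1 d2 : R) :
  0 <= D -> 0 <= Gam -> 0 < eps -> Gam * D <= 2 * L -> eps * L <= r ->
  0 <= d1 -> d1 <= D -> 0 <= d2 -> d1 <= d2 + r ->
  d1 ^+ 2 - d2 ^+ 2 + eps * Gam * D ^+ 2 / 4 <= D ^+ 2 + 3 / 4 * (eps * Gam * D * r).
Proof.
move=> D0 Gam0 eps0 GDL eLr d10 d1D d20 d1r.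
have d1D2 : d1 ^+ 2 <= D ^+ 2 by rewrite lerXn2r ?nnegrE.
have eGD0 : 0 <= eps * Gam * D by rewrite !mulr_ge0// ltW.
have [Dr|rD] := leP D (3 * r).
  have := ler_wpM2l eGD0 Dr; have := sqr_ge0 d2; lra.
have r0 : 0 <= r.
  by apply: le_trans eLr; rewrite mulr_ge0 ?(ltW eps0)//; have := mulr_ge0 Gam0 D0; lra.
have h1 : d1 ^+ 2 - d2 ^+ 2 <= 2 * (D * r).
  rewrite subr_sqr; have [d12|d21] := leP d1 d2.
    apply: (@le_trans _ _ 0); last by rewrite !mulr_ge0.
    by rewrite mulr_le0_ge0 ?subr_le0// addr_ge0.
  rewrite (_ : 2 * (D * r) = r * (2 * D)); last by ring.
  by apply: ler_pM; rewrite ?subr_ge0 ?addr_ge0 ?(ltW d21)//; lra.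
have h2 : eps * Gam * D ^+ 2 <= 2 * (D * r).
  have := ler_wpM2l (ltW eps0) (ler_wpM2r D0 GDL); have := ler_wpM2r D0 eLr; lra.
have h3 : D * r <= D ^+ 2 / 3.
  by have := ler_wpM2l D0 (ltW rD); lra.
have := mulr_ge0 eGD0 r0; have := sqr_ge0 D; lra.
Qed.

(** * One step of the scheme, then the sum over a run *)

Section GradientScheme.
Variables (R : realType) (N : nat) (X : R) (Xm Xp : 'I_N -> R).
Variables (D Gam G : R) (g : 'I_N -> R -> R) (xstar : 'rV[R]_N).
Let B := budgets X Xm Xp.
Hypothesis Gam_ge0 : 0 <= Gam.
Hypothesis Xm_ge0 : forall i, 0 <= Xm i.
Hypothesis diamB : forall u v, B u -> B v -> enorm (u - v) <= D.
Hypothesis g_prod : forall i, productivity (g i).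
Hypothesis g_diff : forall i t, Xm i <= t <= Xp i ->
  nng_twice_derivable (g i) t /\ `|nng_derive2 (g i) t| <= Gam.
Hypothesis g_grad : forall x, B x -> enorm (gradient (total_output g) x) <= G.
Hypothesis Bstar : B xstar.

Let L := G + 2^-1 * Gam * D.

(** By [diff_quotient_derive], the approximate gradient differs from the gradient by at most
    [Gam / 2 * |x - y|] in norm. *)
Lemma enorm_approx_gradient x y : B x -> B y -> enorm (approx_gradient g x y) <= L.
Proof.
move=> Bx By; set u := gradient (total_output g) x.
rewrite -[approx_gradient g x y](subrK u) addrC.
apply: le_trans (ler_enormD _ _) _; apply: lerD; first exact: g_grad.
apply: (@le_trans _ _ (enorm ((Gam / 2) *: (x - y)))).
  apply: enorm_le => i; have [_ xI] := Bx; have [_ yI] := By.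
  rewrite mxE [X in `|_ + X|]mxE gradient_total_output !mxE.
  rewrite normrM [`|Gam / 2|]ger0_norm ?divr_ge0//.
  exact: (diff_quotient_derive (Xm_ge0 i) (g_prod i) (g_diff (i := i)) (xI i) (yI i)).
rewrite enormZ ger0_norm ?divr_ge0// [2^-1 * Gam]mulrC.
by apply: ler_wpM2l; [rewrite divr_ge0|exact: diamB].
Qed.

(** This sums [secant_overestimate] over the coordinates; the inner product has the sign in which
    the squared norm of the unprojected step produces it. *)
Lemma output_gap x y : B x -> B y ->
  total_output g xstar - total_output g x + dot (x - xstar) (approx_gradient g x y)
    <= Gam / 8 * enorm (x - y) ^+ 2.
Proof.
move=> [_ xI] [_ yI]; have [_ sI] := Bstar.
rewrite sqr_enorm /total_output /dot -sumrB -big_split mulr_sumr/=.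
apply: ler_sum => i _; rewrite !mxE -expr2.
have := secant_overestimate (Xm_ge0 i) (g_prod i) (g_diff (i := i)) (xI i) (yI i) (sI i).
by lra.
Qed.

Lemma scheme_step eps x y : 0 < eps -> B x -> B y ->
  2 * eps * (total_output g xstar - total_output g x) <=
    enorm (x - xstar) ^+ 2
    - enorm (eproj B (x + eps *: approx_gradient g x y) - xstar) ^+ 2
    + eps ^+ 2 * L ^+ 2 + eps * Gam / 4 * enorm (x - y) ^+ 2.
Proof.
move=> eps0 Bx By; set t := approx_gradient g x y.
have tL : enorm t ^+ 2 <= L ^+ 2.
  have tL := enorm_approx_gradient Bx By.
  by rewrite lerXn2r ?nnegrE ?(le_trans _ tL) ?enorm_ge0.
have h1 : enorm (eproj B (x + eps *: t) - xstar) ^+ 2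
    <= enorm (x - xstar + eps *: t) ^+ 2.
  rewrite ler_pXn2r ?nnegrE ?enorm_ge0// (addrAC x).
  exact: eproj_budgets_dist.
move: h1; rewrite (sqr_enormD (x - xstar)) enormZ exprMn.
rewrite real_normK ?num_real// dotZr => h1.
have := ler_wpM2l (ltW eps0) (output_gap Bx By); rewrite -/t => h2.
have := ler_wpM2l (sqr_ge0 eps) tL.
by lra.
Qed.

(** Since [x] itself lies in [B], projecting does not increase the distance to it. *)
Lemma scheme_move eps x y : 0 < eps -> B x -> B y ->
  enorm (eproj B (x + eps *: approx_gradient g x y) - x) <= eps * L.
Proof.
move=> eps0 Bx By; apply: le_trans (eproj_budgets_dist _ Bx) _.
rewrite addrAC subrr add0r enormZ gtr0_norm// ler_wpM2l ?(ltW eps0)//.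
exact: enorm_approx_gradient.
Qed.

Section Run.
Variables (eps : R) (x : nat -> 'rV[R]_N).
Hypotheses (eps_gt0 : 0 < eps) (x_scheme : gradient_scheme B g eps x).

Lemma scheme_budgets k : B (x k).
Proof.
have [B0 B1 xE] := x_scheme; case: k => [//|[//|k]].
by rewrite xE//; apply: (eproj_budgets _ _).1; exists xstar.
Qed.

Lemma scheme_increment k : enorm (x k.+2 - x k.+1) <= eps * L.
Proof.
have [_ _ xE] := x_scheme; rewrite xE//.
by apply: scheme_move => //; exact: scheme_budgets.
Qed.

Let d k := enorm (x k - xstar).

(** Each step from [x 1] on moves by at most [eps * L]. This supplies [d1 <= d2 + r] in
    [first_step_absorbed]. *)
Lemma scheme_dist k : d 1 <= d k.+1 + k%:R * (eps * L).
Proof.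
elim: k => [|k IH]; first by rewrite mul0r addr0.
have : d k.+1 <= d k.+2 + eps * L.
  rewrite /d -(subrKA (x k.+2)) addrC (le_trans (ler_enormD _ _))// lerD2l.
  by rewrite -enormN opprB; exact: scheme_increment.
by rewrite -natr1; lra.
Qed.

(** The squared distances telescope. The last term is the error of the first step, the one before it
    that of the [k] later steps. *)
Lemma scheme_sum k :
  2 * eps * \sum_(1 <= j < k.+2) (total_output g xstar - total_output g (x j)) <=
    d 1 ^+ 2 - d k.+2 ^+ 2 + k.+1%:R * (eps ^+ 2 * L ^+ 2)
    + k%:R * (eps ^+ 2 * (Gam * D * L) / 4) + eps * Gam * D ^+ 2 / 4.
Proof.
have [_ _ xE] := x_scheme; have Bx := scheme_budgets.
have eG0 : 0 <= eps * Gam / 4 by rewrite !mulr_ge0 ?invr_ge0// ltW.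
elim: k => [|k IH].
  rewrite big_nat1 mul0r addr0 mul1r.
  have := scheme_step eps_gt0 (Bx 1%N) (Bx 0%N).
  rewrite -(xE 1%N)// -/(d 1) -/(d 2).
  have : enorm (x 1%N - x 0%N) ^+ 2 <= D ^+ 2.
    have D1 := diamB (Bx 1%N) (Bx 0%N).
    by rewrite lerXn2r ?nnegrE ?(le_trans _ D1) ?enorm_ge0.
  by move=> /(ler_wpM2l eG0); lra.
rewrite big_nat_recr//= mulrDr.
have := scheme_step eps_gt0 (Bx k.+2) (Bx k.+1).
rewrite -(xE k.+2)// -/(d k.+2) -/(d k.+3).
(* One factor is bounded by the step length [eps * L], the other by the diameter. *)
have : enorm (x k.+2 - x k.+1) ^+ 2 <= eps * L * D.
  by rewrite expr2 ler_pM ?enorm_ge0 ?diamB// scheme_increment.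
move=> /(ler_wpM2l eG0) h1 h2.
rewrite -[k.+2%:R]natr1 -[X in X * (_ / 4)]natr1.
by lra.
Qed.

Lemma scheme_regret k : (1 <= k)%N ->
  k%:R^-1 * \sum_(1 <= j < k.+1) (total_output g xstar - total_output g (x j)) <=
  (2 * eps * k%:R)^-1 *
    (D ^+ 2 + eps ^+ 2 * k%:R *
       ((G + 2^-1 * Gam * D) * (G + 3 / 2 * Gam * D))).
Proof.
case: k => // k _; set S := \sum_(_ <= _ < _) _.
have k0 : 0 < k.+1%:R :> R by rewrite ltr0Sn.
have -> : k.+1%:R^-1 * S = (2 * eps * k.+1%:R)^-1 * (2 * eps * S).
  by move: k0; set K := k.+1%:R => K0; field; rewrite !gt_eqF.
apply: ler_wpM2l; first by rewrite invr_ge0 !mulr_ge0// ltW.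
apply: le_trans (scheme_sum k) _.
have Bx := scheme_budgets.
have D0 : 0 <= D by exact: le_trans (enorm_ge0 _) (diamB Bstar Bstar).
have G0 : 0 <= G by exact: le_trans (enorm_ge0 _) (g_grad Bstar).
have GD0 : 0 <= Gam * D by exact: mulr_ge0.
have L0 : 0 <= L by rewrite /L; lra.
have eL : eps * L <= k.+1%:R * (eps * L).
  by apply: ler_peMl; [exact: mulr_ge0 (ltW eps_gt0) L0|rewrite ler1n].
have GDL : Gam * D <= 2 * L by rewrite /L; lra.
(* With [r = k.+1 * (eps * L)], the first error costs at most [3/4] of [k.+1 * eps^2 * Gam * D * L],
   and the later errors at most the remaining quarter. *)
have := first_step_absorbed D0 Gam_ge0 eps_gt0 GDL eL (enorm_ge0 _)
  (diamB (Bx 1%N) Bstar) (enorm_ge0 _) (scheme_dist k.+1).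
rewrite -/(d 1) -/(d k.+2).
have := mulr_ge0 (sqr_ge0 eps) (mulr_ge0 GD0 L0).
rewrite -[k.+1%:R]natr1.
rewrite (_ : G + 3 / 2 * Gam * D = L + Gam * D); last by rewrite /L; lra.
by rewrite -/L; lra.
Qed.

End Run.
End GradientScheme.

(** * The limit of the bound, and the theorem *)

Lemma cvg_regret_bound (R : realType) (D eps C : R) : 0 < eps ->
  (2 * eps * k%:R)^-1 * (D ^+ 2 + eps ^+ 2 * k%:R * C) @[k --> \oo]
    --> eps / 2 * C.
Proof.
move=> eps0.
have kc : (k%:R^-1 : R) @[k --> \oo] --> (0 : R).
  by rewrite -(cvg_shiftS (fun k => k%:R^-1 : R)); exact: cvg_harmonic.
have : (D ^+ 2 / (2 * eps) * k%:R^-1 + eps / 2 * C) @[k --> \oo]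
    --> D ^+ 2 / (2 * eps) * 0 + eps / 2 * C.
  by apply: cvgD; [apply: cvgM; [exact: cvg_cst|exact: kc]|exact: cvg_cst].
rewrite mulr0 add0r; apply: cvg_trans.
apply: near_eq_cvg; near=> k.
have k0 : k%:R != 0 :> R by rewrite pnatr_eq0 -lt0n; near: k; exact: nbhs_infty_gt.
by field; rewrite k0 gt_eqF.
Unshelve. all: by end_near. Qed.

Theorem mainTheorem3 (R : realType) (N : nat) (X : R) (Xm Xp : 'I_N -> R)
    (D Gam G : R) (g : 'I_N -> R -> R) (xstar : 'rV[R]_N)
    (hN : (1 <= N)%N)
    (hX : 0 < X)
    (hXmp : forall i, 0 <= Xm i <= Xp i)
    (hB : budgets X Xm Xp !=set0)
    (hD : D = ediam (budgets X Xm Xp))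
    (hg : forall i, productivity (g i))
    (hg2 : forall i t, Xm i <= t <= Xp i ->
       nng_twice_derivable (g i) t /\ `|nng_derive2 (g i) t| <= Gam)
    (hG : forall x, budgets X Xm Xp x -> enorm (gradient (total_output g) x) <= G)
    (hstar : budgets X Xm Xp xstar)
    (hmax : forall x, budgets X Xm Xp x -> total_output g x <= total_output g xstar) :
  [/\ (* the regret bound *)
      forall (eps : R) (x : nat -> 'rV[R]_N), 0 < eps ->
        gradient_scheme (budgets X Xm Xp) g eps x ->
        forall k : nat, (1 <= k)%N ->
          k%:R^-1 * \sum_(1 <= j < k.+1) (total_output g xstar - total_output g (x j)) <=
          (2 * eps * k%:R)^-1 *
            (D ^+ 2 + eps ^+ 2 * k%:R *
               ((G + 2^-1 * Gam * D) * (G + 3 / 2 * Gam * D))),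
      (* the limit of the bound as k tends to infinity *)
      forall eps : R, 0 < eps ->
        (2 * eps * k%:R)^-1 *
          (D ^+ 2 + eps ^+ 2 * k%:R *
             ((G + 2^-1 * Gam * D) * (G + 3 / 2 * Gam * D)))
          @[k --> \oo] -->
        eps / 2 * ((G + 2^-1 * Gam * D) * (G + 3 / 2 * Gam * D)),
      (* this limit is arbitrarily small for small eps *)
      forall eta : R, 0 < eta -> exists2 eps0 : R, 0 < eps0 &
        forall eps : R, 0 < eps <= eps0 ->
          eps / 2 * ((G + 2^-1 * Gam * D) * (G + 3 / 2 * Gam * D)) < eta &
      (* the average output is eventually within eta of the optimal output *)
      forall eta : R, 0 < eta -> exists2 eps0 : R, 0 < eps0 &
        forall (eps : R) (x : nat -> 'rV[R]_N), 0 < eps <= eps0 ->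
          gradient_scheme (budgets X Xm Xp) g eps x ->
          \forall k \near \oo,
            `|k%:R^-1 * \sum_(1 <= j < k.+1) total_output g (x j) - total_output g xstar|
              < eta].
Proof.
(* Some coordinate exists, and the second derivative bound at its lower limit forces [Gam] to be
   nonnegative. *)
pose i0 : 'I_N := Ordinal hN.
have Gam0 : 0 <= Gam.
  have /andP[_ XmXp] := hXmp i0.
  have [|_] := hg2 i0 (Xm i0); first by rewrite lexx.
  exact: le_trans.
have Xm0 i : 0 <= Xm i by have /andP[] := hXmp i.
have diamB u v : budgets X Xm Xp u -> budgets X Xm Xp v -> enorm (u - v) <= D.
  by rewrite hD; exact: enorm_le_ediam.
have D0 : 0 <= D by exact: le_trans (enorm_ge0 _) (diamB _ _ hstar hstar).
have G0 : 0 <= G by exact: le_trans (enorm_ge0 _) (hG _ hstar).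
set C := (G + 2^-1 * Gam * D) * (G + 3 / 2 * Gam * D).
have C0 : 0 <= C by rewrite mulr_ge0// addr_ge0// mulr_ge0// mulr_ge0.
have regret := scheme_regret Gam0 Xm0 diamB hg hg2 hG hstar.
have small eta : 0 < eta -> exists2 eps0 : R, 0 < eps0 &
    forall eps : R, 0 < eps <= eps0 -> eps / 2 * C < eta.
  move=> eta0; have C1 : 0 < C + 1 by rewrite ltr_wpDl.
  (* Adding 1 keeps the denominator positive when [C = 0]. *)
  exists (eta / (C + 1)); first by rewrite divr_gt0.
  move=> eps /andP[eps0]; rewrite ler_pdivlMr// => epsC.
  by have := mulr_ge0 (ltW eps0) C0; lra.
split => //.
- by move=> eps eps0; exact: cvg_regret_bound.
- move=> eta /small[eps0 eps0_gt0 epsC]; exists eps0 => // eps x epsI xS.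
  have /andP[eps_gt0 _] := epsI.
  have bound_lt := cvgr_lt _ (@cvg_regret_bound _ D _ C eps_gt0) _ (epsC _ epsI).
  near=> k.
  have k0 : (0 < k)%N by near: k; exact: nbhs_infty_gt.
  have kR0 : 0 < k%:R :> R by rewrite ltr0n.
  have -> : k%:R^-1 * \sum_(1 <= j < k.+1) total_output g (x j) - total_output g xstar =
      - (k%:R^-1 * \sum_(1 <= j < k.+1) (total_output g xstar - total_output g (x j))).
    rewrite sumrB sumr_const_nat subn1/= -(mulr_natl (total_output g xstar)) mulrBr mulKf ?gt_eqF//.
    by rewrite opprB.
  (* By maximality of [xstar] the regret is nonnegative, so the upper bound on it also bounds the
     absolute value. *)
  rewrite normrN ger0_norm; last first.
    rewrite mulr_ge0 ?invr_ge0// sumr_ge0// => j _; rewrite subr_ge0 hmax//.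
    by have := scheme_budgets hstar xS; exact.
  have /le_lt_trans := regret _ _ eps_gt0 xS _ k0; apply.
  by near: k; exact: bound_lt.
Unshelve. all: by end_near. Qed.
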